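(* For every positive integer $n$, $q(n)-q(n-1)-q(n-2)\leqslant 0$.
   Context: $q(n)$ denotes the number of partitions of the positive integer $n$ into odd parts (equivalently, into distinct parts); $q(0)=1$ and $q(n)=0$ for negative integers $n$. *)

(* Defs.v *)
From mathcomp Require Import all_boot all_order all_algebra.

Set Implicit Arguments.
Unset Strict Implicit.
Unset Printing Implicit Defensive.

(* A partition is written as the nonincreasing sequence of its parts. *)
Definition is_partition (n : nat) (s : seq nat) : bool :=
  [&& sorted geq s, all (fun k => 0 < k) s & sumn s == n].

Definition is_odd_partition (n : nat) (s : seq nat) : bool :=
  is_partition n s && all odd s.

(* A partition of n has at most n parts, each at most n, so that counting over
   the finite type n.-bseq 'I_n.+1 misses none: see is_odd_partition_bseq. *)
Definition odd_partitions (n : nat) : {set n.-bseq 'I_n.+1} :=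
  [set s : n.-bseq 'I_n.+1 | is_odd_partition n (map val s)].

Definition q (k : int) : nat :=
  match k with
  | Posz n => #|odd_partitions n|
  | Negz _ => 0
  end.

Lemma is_odd_partition_bseq (n : nat) (s : seq nat) :
  is_odd_partition n s ->
  exists2 t : n.-bseq 'I_n.+1, t \in odd_partitions n & map val t = s.
Proof.
move=> sP; move: (sP) => /andP[/and3P[_ pos_s /eqP sum_s] _].
have size_s : size s <= n.
  rewrite -sum_s; elim: s pos_s {sP sum_s} => //= k s IHs /andP[k_gt0 /IHs le_s].
  by rewrite -add1n leq_add.
have ltn_s : all (fun k => k < n.+1) s.
  rewrite -sum_s; apply/allP => k {sP pos_s sum_s size_s}.
  elim: s => //= x s IHs; rewrite inE ltnS => /predU1P[-> | /IHs].
    exact: leq_addr.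
  by rewrite ltnS => /leq_trans-> //; apply: leq_addl.
have map_s : map val (map (inord : nat -> 'I_n.+1) s) = s.
  rewrite -map_comp map_id_in // => k /(allP ltn_s) k_le /=.
  by rewrite inordK.
have size_t : size (map (inord : nat -> 'I_n.+1) s) <= n by rewrite size_map.
by exists (Bseq size_t); rewrite ?inE /= map_s.
Qed.

(* Main.v *)
(** An odd partition of [n] either ends with a part [1], and removing it leaves
    an odd partition of [n - 1]; or its smallest part is at least [3], and
    lowering it by [2] leaves an odd partition of [n - 2].  So those of [n] are
    all reached from those of [n - 1] by appending a [1], or from those of
    [n - 2] by raising the last part by [2]. *)
Require Import Defs.
From mathcomp Require Import all_boot all_order all_algebra.
From mathcomp Require Import zify.

Local Open Scope ring_scope.

(** The type [n.-bseq 'I_n.+1] depends on [n]; plain sequences allow partitions of different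
    integers to be compared. *)
Definition odd_partition_seqs (n : nat) : seq (seq nat) :=
  [seq map val s | s : n.-bseq 'I_n.+1 in odd_partitions n].

Lemma mem_odd_partition_seqs (n : nat) (s : seq nat) :
  (s \in odd_partition_seqs n) = is_odd_partition n s.
Proof.
apply/imageP/idP => [[t] | /is_odd_partition_bseq[t tP <-]]; last by exists t.
by rewrite inE => tP ->.
Qed.

Lemma uniq_odd_partition_seqs (n : nat) : uniq (odd_partition_seqs n).
Proof.
rewrite map_inj_uniq ?enum_uniq // => s t /(inj_map val_inj).
exact: val_inj.
Qed.

Lemma size_odd_partition_seqs (n : nat) :
  size (odd_partition_seqs n) = q n%:Z.
Proof. by rewrite size_map -cardE. Qed.

(** Positivity of the parts is absorbed by oddness, and the last part is the smallest. *)
Lemma is_odd_partition_rcons (n k : nat) (s : seq nat) :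
  is_odd_partition n (rcons s k) =
  [&& all (geq^~ k) s, sorted geq s, all odd s, odd k & (sumn s + k == n)%N].
Proof.
have geq_trans : transitive geq by move=> a b c /= ab bc; apply: leq_trans ab.
have odd_pos : {subset odd <= (fun i : nat => (0 < i)%N)} by case.
rewrite /is_odd_partition /is_partition !(sorted_pairwise geq_trans).
rewrite pairwise_rcons !all_rcons sumn_rcons.
have [odds | _] := boolP (all odd s); last by rewrite !andbF.
rewrite (sub_all odd_pos odds) !andbT.
by case: k => [|k]; rewrite ?andbF //= -!andbA; do !bool_congr.
Qed.

(** The default [[::]] is met only at the empty partition of 0. *)
Definition raise_last (s : seq nat) : seq nat :=
  if rev s is k :: t then rcons (rev t) k.+2 else [::].

Lemma raise_last_rcons (s : seq nat) (k : nat) :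
  raise_last (rcons s k) = rcons s k.+2.
Proof. by rewrite /raise_last rev_rcons revK. Qed.

Lemma odd_partition_rcons1 (n : nat) (s : seq nat) :
  is_odd_partition n.+1 (rcons s 1) -> is_odd_partition n s.
Proof.
rewrite is_odd_partition_rcons addn1 eqSS => /and5P[_ sorted_s odd_s _ sum_s].
rewrite /is_odd_partition /is_partition sorted_s odd_s sum_s !andbT.
by apply: sub_all odd_s; case.
Qed.

(** Subtracting 2 keeps the parity, hence also positivity, and the last part stays the smallest. *)
Lemma odd_partition_lower_last (n k : nat) (s : seq nat) :
  is_odd_partition n.+2 (rcons s k.+2) -> is_odd_partition n (rcons s k).
Proof.
rewrite !is_odd_partition_rcons !addnS !eqSS /= negbK.
move=> /and5P[le_s -> -> -> ->]; rewrite !andbT.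
by apply: sub_all le_s => i /= /ltnW/ltnW.
Qed.

Lemma leq_q1_q0 : (q 1%:Z <= q 0%:Z)%N.
Proof.
rewrite -!size_odd_partition_seqs.
rewrite -(size_map (rcons^~ 1%N) (odd_partition_seqs 0)).
apply: uniq_leq_size (uniq_odd_partition_seqs _) _ => s.
rewrite mem_odd_partition_seqs; case/lastP: s => [//|s [|[|k]]] sP.
- by move: sP; rewrite is_odd_partition_rcons !andbF.
- by rewrite (map_f (rcons^~ 1%N)) // mem_odd_partition_seqs odd_partition_rcons1.
(* A last part of at least 2 exceeds the total 1. *)
- by move: sP; rewrite is_odd_partition_rcons !addnS !andbF.
Qed.

Lemma leq_q_add (n : nat) : (q n.+2%:Z <= q n.+1%:Z + q n%:Z)%N.
Proof.
rewrite -!size_odd_partition_seqs.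
rewrite -(size_map (rcons^~ 1%N) (odd_partition_seqs n.+1)).
rewrite -(size_map raise_last (odd_partition_seqs n)) -size_cat.
(* A duplicate-free list is no longer than any list containing its elements, so it suffices that the
   two images cover the partitions of [n.+2]. *)
apply: uniq_leq_size (uniq_odd_partition_seqs _) _ => s.
rewrite mem_odd_partition_seqs mem_cat; case/lastP: s => [//|s [|[|k]]] sP.
- by move: sP; rewrite is_odd_partition_rcons !andbF.
- by rewrite (map_f (rcons^~ 1%N)) // mem_odd_partition_seqs odd_partition_rcons1.
- apply/orP; right; rewrite -raise_last_rcons; apply: map_f.
  by rewrite mem_odd_partition_seqs odd_partition_lower_last.
Qed.

Theorem theorem4 (n : nat) (n_gt0 : (0 < n)%N) :
  (q n%:Z)%:Z - (q (n%:Z - 1))%:Z - (q (n%:Z - 2))%:Z <= 0.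
Proof.
case: n n_gt0 => [//|[|n] _].
  (* For [n = 1] the bound by [q 0] is enough, as the other subtracted term is a natural number. *)
  have -> : 1%:Z - 1 = 0%:Z by lia.
  by have := leq_q1_q0; lia.
have -> : n.+2%:Z - 1 = n.+1%:Z by lia.
have -> : n.+2%:Z - 2 = n%:Z by lia.
by have := leq_q_add n; lia.
Qed.
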